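(* Let $m$ and $n$ be two positive integers, let $l=\mathrm{lcm}(m,n)$, and let $p_1,\dots,p_k$ be the distinct primes dividing $l$. Write $m=p_1^{\alpha_1}\cdots p_k^{\alpha_k}$ and $n=p_1^{\beta_1}\cdots p_k^{\beta_k}$, where the exponents $\alpha_i,\beta_i\ge 0$ are integers that can possibly be zero. Then $$|L_1(\mathbb{Z}_m\times\mathbb{Z}_n)|=\frac{1}{\varphi(l)}\,\prod_{i=1}^k\ \sum_{\substack{1\leq m_i\leq p_i^{\max\{\alpha_i,\beta_i\}}\\ p_i\nmid m_i}}\gcd(m_i-1,p_i^{\alpha_i})\gcd(m_i-1,p_i^{\beta_i}).$$
   Context: $\mathbb{Z}_n=\mathbb{Z}/n\mathbb{Z}$ denotes the cyclic group of order $n$ (written additively). $\varphi$ is Euler's totient function, and for a finite abelian group $G$, $|L_1(G)|$ is the number of cyclic subgroups of $G$ (including the trivial subgroup). The convention $\gcd(0,a)=a$ is used for positive integers $a$, and an empty product equals $1$. *)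

(* Defs.v *)
From mathcomp Require Import all_boot all_order all_algebra all_fingroup all_solvable.
Set Implicit Arguments.
Unset Strict Implicit.
Unset Printing Implicit Defensive.

Definition cyclic_subgroups (gT : finGroupType) (G : {set gT}) :
    {set {group gT}} :=
  [set H in subgroups G | cyclic H].

(* [Zp m] is the trivial group for [m = 1], whereas ['Z_1] has two elements. *)
Definition Zp_prod (m n : nat) : {group 'Z_m * 'Z_n} :=
  [group of setX (Zp m) (Zp n)].

(* Main.v *)
Require Import Defs.
From mathcomp Require Import all_boot all_order all_algebra all_fingroup all_solvable.
Set Implicit Arguments.
Unset Strict Implicit.
Unset Printing Implicit Defensive.

(** The formula is the orbit-counting lemma applied to the power maps
    [x |-> x ^+ u], for [u] a unit modulo [l], acting on [G = Z_m x Z_n], whose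
    exponent divides [l].  Two elements are in the same orbit exactly when they
    generate the same cyclic subgroup, because every residue coprime to a divisor
    [d] of [l] lifts to a unit modulo [l].  Hence the number of cyclic subgroups
    times [totient l] is the number of pairs [(u, x)] with [x ^+ u = x], i.e.,
    with [x ^+ (u - 1) = 1].

    This is carried out as a double count ([cyclic_subgroups_Burnside], valid in
    any finite group): the units [u] that fix [x] are those congruent to 1 modulo
    [#[x]], and there are [totient l / totient #[x]] of them
    ([totient_mul_card_unit_residues]); on the other hand a cyclic subgroup of
    order [d] is generated by [totient d] elements, so that it contributes
    [totient l] pairs in all.

    For fixed [u], the solutions of [x ^+ (u - 1) = 1] in [Z_m x Z_n] number
    [gcdn (u - 1) m * gcdn (u - 1) n], which gives
    [card_cyclic_subgroups_Zp_prod].  Both this expression and the condition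
    [coprime u l] are products over the primes [p i] of functions of [u] that are
    periodic modulo [p i ^ maxn (alpha i) (beta i)], and these moduli are coprime
    with product [l], so the Chinese remainder theorem turns the sum over [u] into
    a product of sums ([sum_prod_CRT]).

    Throughout, a unit [u] is written [j.+1] with [0 <= j < l], which absorbs the
    shift in [u - 1]. *)

(** * Units modulo l in a residue class modulo a divisor *)

(** The witness [c + d * t] takes for [t] the part of [l] prime to [c]: a prime
    divisor of [l] divides exactly one of [c] and [d * t], hence not their sum. *)

Lemma coprime_lift d l c : 0 < l -> d %| l -> coprime c d ->
  exists2 u, coprime u l & u = c %[mod d].
Proof.
move=> l_gt0 dvd_dl co_cd.
(* For c = 0, which forces d = 1, the set \pi(c) would be empty, hence t = l. *)
have [-> | d_gt1] := eqVneq d 1; first by exists 1; rewrite ?coprime1n ?modn1.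
have c_gt0 : 0 < c.
  by case: c co_cd => // /eqP; rewrite gcd0n => d1; rewrite d1 in d_gt1.
exists (c + d * l`_(\pi(c)^')); last by rewrite addnC mulnC modnMDl.
rewrite coprime_has_primes ?addn_gt0 //; last first.
  by rewrite muln_gt0 part_gt0 (dvdn_gt0 l_gt0 dvd_dl) orbT.
apply/hasPn => q; rewrite mem_primes => /and3P[q_pr _ q_dvd_l].
rewrite /= mem_primes q_pr /= negb_and; apply/orP; right.
have [q_dvd_c | q_ndvd_c] := boolP (q %| c).
  rewrite dvdn_addr // Euclid_dvdM // negb_or.
  apply/andP; split.
    apply/negP => q_dvd_d.
    have: q %| gcdn c d by rewrite dvdn_gcd q_dvd_c.
    by rewrite (eqP co_cd) dvdn1 => /eqP q1; rewrite q1 in q_pr.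
  apply: contraL q_dvd_c => q_dvd_t.
  have := pnat_dvd q_dvd_t (part_pnat \pi(c)^' l).
  by rewrite pnatE // inE /= mem_primes q_pr c_gt0.
rewrite dvdn_addl // dvdn_mull //.
have: q \in primes l`_(\pi(c)^').
  rewrite primes_part mem_filter mem_primes q_pr l_gt0 q_dvd_l inE /= mem_primes.
  by rewrite (negPf q_ndvd_c) !andbF.
by rewrite mem_primes => /and3P[].
Qed.

Definition unit_residues (l d c : nat) : {set 'I_l} :=
  [set j : 'I_l | coprime j l & j == c %[mod d]].

(** Multiplication by the unit [u] injects the class of [c] into that of [c * u].
    An inequality suffices, since it can be used again with the inverse of [u]. *)
Lemma leq_unit_residues_mul l d c u : d %| l -> coprime u l ->
  #|unit_residues l d c| <= #|unit_residues l d (c * u)|.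
Proof.
move=> dvd_dl co_ul; case: l => [|l] in dvd_dl co_ul *.
  by rewrite [#|unit_residues 0 d c|]eq_card0 // => -[].
pose h (j : 'I_l.+1) : 'I_l.+1 := Ordinal (ltn_pmod (j * u) (ltn0Sn l)).
have h_inj : injective h.
  move=> i j; wlog le_ji : i j / j <= i => [IH eq_ij|].
    by case/orP: (leq_total j i) => le; [|symmetry]; apply: IH.
  move/(congr1 val)/eqP; rewrite /= !(mulnC _ u).
  rewrite eqn_mod_dvd ?leq_mul2l ?le_ji ?orbT // -mulnBr.
  rewrite Gauss_dvdr 1?coprime_sym // -eqn_mod_dvd // !modn_small //.
  by move/eqP/val_inj.
rewrite -(card_imset _ h_inj); apply/subset_leq_card/subsetP => _ /imsetP[j Uj ->].
move: Uj; rewrite !inE /= coprime_modl coprimeMl co_ul => /andP[-> /eqP eq_jc].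
by apply/eqP; rewrite modn_dvdm // -[LHS]modnMml eq_jc modnMml.
Qed.

(** All classes of units modulo [d] are hit equally often by the units modulo [l]:
    a lift of [c] multiplies the class of 1 into that of [c], and its inverse
    multiplies it back. *)
Lemma card_unit_residues l d c : 0 < l -> d %| l -> coprime c d ->
  #|unit_residues l d c| = #|unit_residues l d 1|.
Proof.
move=> l_gt0 dvd_dl co_cd.
have [u co_ul u_c] := coprime_lift l_gt0 dvd_dl co_cd.
(* By Euler's theorem, a power of u is an inverse of u. *)
have [v uv1] : exists v, u * v = 1 %[mod l].
  exists (u ^ (totient l).-1).
  by rewrite -expnS prednK ?totient_gt0 // Euler_exp_totient.
have co_vl : coprime v l.
  have := coprime1n l.
  by rewrite -coprime_modl -uv1 coprime_modl coprimeMl => /andP[].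
have eq_mod c1 c2 : c1 = c2 %[mod d] ->
  unit_residues l d c1 = unit_residues l d c2.
  by move=> eq_c; apply/setP => j; rewrite !inE eq_c.
apply/eqP; rewrite eqn_leq -(eq_mod u c) //.
rewrite -[in X in _ && X](mul1n u) leq_unit_residues_mul // andbT.
rewrite -(eq_mod (u * v) 1) ?leq_unit_residues_mul //.
by rewrite -(modn_dvdm _ dvd_dl) uv1 modn_dvdm.
Qed.

(** The units modulo [l] are partitioned by their class modulo [d] into
    [totient d] sets of equal size. *)
Lemma totient_mul_card_unit_residues l d : 0 < l -> d %| l ->
  totient d * #|unit_residues l d 1| = totient l.
Proof.
move=> l_gt0 dvd_dl; have d_gt0 := dvdn_gt0 l_gt0 dvd_dl.
pose r (j : 'I_l) : 'I_d := Ordinal (ltn_pmod j d_gt0).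
rewrite !totient_count_coprime !big_mkord.
rewrite -big_mkcond -[RHS]big_mkcond /=.
rewrite [RHS](partition_big r (fun c : 'I_d => coprime d c)) => [|j /=]; last first.
  by rewrite coprime_modr => /(coprime_dvdl dvd_dl).
rewrite big_distrl /=; apply: eq_bigr => c co_dc.
rewrite mul1n -(card_unit_residues l_gt0 dvd_dl (c := c)) 1?coprime_sym //.
rewrite -sum1_card.
apply: eq_bigl => j; rewrite inE coprime_sym -val_eqE /=.
by rewrite (modn_small (ltn_ord c)).
Qed.

(** * Sums of products of periodic functions *)

Definition periodic a (f : nat -> nat) := forall j, f (j %% a) = f j.

(** By the Chinese remainder theorem, [j] runs over the residues modulo [a * b] as
    its residues modulo [a] and modulo [b] run independently. *)
Lemma sum_CRT a b (f g : nat -> nat) : coprime a b ->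
  periodic a f -> periodic b g ->
  \sum_(0 <= j < a * b) f j * g j
    = (\sum_(0 <= j < a) f j) * \sum_(0 <= j < b) g j.
Proof.
move=> co_ab per_f per_g.
case: (posnP a) => [->|a_gt0]; first by rewrite mul0n !big_nil.
case: (posnP b) => [->|b_gt0]; first by rewrite muln0 !big_nil muln0.
have ab_gt0 : 0 < a * b by rewrite muln_gt0 a_gt0.
rewrite !big_mkord big_distrlr /= pair_bigA /=.
pose h (ij : 'I_a * 'I_b) : 'I_(a * b) :=
  Ordinal (ltn_pmod (chinese a b ij.1 ij.2) ab_gt0).
pose h' (j : 'I_(a * b)) : 'I_a * 'I_b :=
  (Ordinal (ltn_pmod j a_gt0), Ordinal (ltn_pmod j b_gt0)).
have hK : cancel h h'.
  case=> i j; apply/eqP; rewrite xpair_eqE -!val_eqE /=.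
  apply/andP; split; apply/eqP.
    by rewrite modn_dvdm ?dvdn_mulr // chinese_modl // modn_small.
  by rewrite modn_dvdm ?dvdn_mull // chinese_modr // modn_small.
have h'K : cancel h' h.
  by move=> j; apply: val_inj => /=; rewrite -chinese_mod // modn_small.
rewrite (reindex h') /=; last by exists h => ? _.
by apply: eq_bigr => j _; rewrite /= per_f per_g.
Qed.

Lemma periodic_dvdn a b f : a %| b -> periodic a f -> periodic b f.
Proof. by move=> dvd_ab per_f j; rewrite -per_f modn_dvdm // per_f. Qed.

Lemma coprime_prod (I : Type) (r : seq I) (q : I -> nat) a :
  coprime a (\prod_(i <- r) q i) = all (fun i => coprime a (q i)) r.
Proof.
elim: r => [|i r IHr] /=; first by rewrite big_nil coprimen1.
by rewrite big_cons coprimeMr IHr.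
Qed.

Lemma prod_nat_of_bool (I : Type) (r : seq I) (P : pred I) :
  \prod_(i <- r) P i = all P r :> nat.
Proof. by elim: r => [|i r IHr] /=; rewrite ?big_nil // big_cons IHr mulnb. Qed.

Lemma sum_prod_CRT (I : eqType) (r : seq I) (q : I -> nat)
    (f : I -> nat -> nat) :
    uniq r -> {in r &, forall i j, i != j -> coprime (q i) (q j)} ->
    (forall i, periodic (q i) (f i)) ->
  \sum_(0 <= j < \prod_(i <- r) q i) \prod_(i <- r) f i j
    = \prod_(i <- r) \sum_(0 <= j < q i) f i j.
Proof.
move=> + + per_f; elim: r => [|i r IHr] /= => [_ _|/andP[r'i uniq_r] co_q].
  by rewrite !big_nil big_nat1 big_nil.
rewrite !big_cons -IHr // => [|i1 i2 ri1 ri2]; last first.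
  by apply: co_q; rewrite inE ?ri1 ?ri2 orbT.
under eq_bigr do rewrite big_cons.
apply: sum_CRT => //.
  rewrite coprime_prod; apply/allP => j rj.
  by rewrite co_q ?inE ?eqxx ?rj ?orbT //; apply: contraNneq r'i => ->.
move=> j; apply: eq_big_seq => i1 ri1; apply: (periodic_dvdn _ (per_f i1)).
by rewrite (bigD1_seq i1) //= dvdn_mulr.
Qed.

Lemma gcdnMr_coprime k a b : coprime a b ->
  gcdn k (a * b) = gcdn k a * gcdn k b.
Proof.
move=> co_ab; apply/eqP; rewrite eqn_dvd; apply/andP; split.
  rewrite muln_gcdr !muln_gcdl !dvdn_gcd.
  rewrite !(dvdn_mulr _ (dvdn_gcdl k (a * b))) dvdn_gcdr andbT.
  by rewrite dvdn_mull ?dvdn_gcdl.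
rewrite dvdn_gcd Gauss_dvd ?dvdn_gcdl ?dvdn_mul ?dvdn_gcdr //.
exact: coprime_dvdl (dvdn_gcdr _ _) (coprime_dvdr (dvdn_gcdr _ _) co_ab).
Qed.

Lemma gcdn_prod (I : eqType) (r : seq I) (q : I -> nat) k :
    uniq r -> {in r &, forall i j, i != j -> coprime (q i) (q j)} ->
  gcdn k (\prod_(i <- r) q i) = \prod_(i <- r) gcdn k (q i).
Proof.
elim: r => [|i r IHr] /= => [_ _|/andP[r'i uniq_r] co_q].
  by rewrite !big_nil gcdn1.
rewrite !big_cons gcdnMr_coprime ?IHr // => [i1 i2 ri1 ri2|].
  by apply: co_q; rewrite inE ?ri1 ?ri2 orbT.
rewrite coprime_prod; apply/allP => j rj.
by rewrite co_q ?inE ?eqxx ?rj ?orbT //; apply: contraNneq r'i => ->.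
Qed.

(** * Products of prime powers *)

Lemma logn_prod (I : finType) (q a : I -> nat) r :
    (forall i, prime (q i)) ->
  (logn r (\prod_i q i ^ a i) = \sum_(i | r == q i) a i).
Proof.
move=> q_pr.
have q_gt0 i : (0 < q i ^ a i) by rewrite expn_gt0 prime_gt0.
rewrite [RHS]big_mkcond /=.
(* The positivity is carried along since lognM needs nonzero factors. *)
have [_ ->] : 0 < \prod_i q i ^ a i /\
    logn r (\prod_i q i ^ a i) = \sum_i logn r (q i ^ a i).
  elim/big_rec2: _ => [|i s t _ [t_gt0 <-]]; first by rewrite logn1.
  by rewrite muln_gt0 q_gt0 lognM.
apply: eq_bigr => i _.
by rewrite lognX logn_prime // mulnbr.
Qed.

Lemma lcmn_prod_primes (I : finType) (q a b : I -> nat) :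
    injective q -> (forall i, prime (q i)) ->
  (lcmn (\prod_i q i ^ a i) (\prod_i q i ^ b i)
    = \prod_i q i ^ maxn (a i) (b i)).
Proof.
move=> q_inj q_pr.
have prod_gt0 e : (0 < \prod_i q i ^ e i).
  by rewrite prodn_gt0 // => i; rewrite expn_gt0 prime_gt0.
apply: eqn_from_log => [||r]; rewrite ?lcmn_gt0 ?prod_gt0 //.
rewrite logn_lcm // !logn_prod //.
have [/existsP[i /eqP ->] | /existsPn no_i] := boolP [exists i, r == q i].
  have eq_q j : (q i == q j) = (j == i) by rewrite (inj_eq q_inj) eq_sym.
  by rewrite !(eq_bigl _ _ eq_q) !big_pred1_eq.
by rewrite !big1 // => i /(negP (no_i i)).
Qed.

(** * Counting cyclic subgroups by their generators *)

Local Open Scope group_scope.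

(** Grouping the elements by the subgroup they generate, the class of a cyclic
    subgroup [H] consists of its [totient #|H|] generators, all of order [#|H|]. *)
Lemma sum_by_cyclic_subgroup (gT : finGroupType) (G : {group gT})
    (F : nat -> nat) :
  (\sum_(x in G) F #[x]
    = \sum_(H in cyclic_subgroups G) totient #|H| * F #|H|)%N.
Proof.
rewrite (partition_big (fun x => <[x]>%G) (mem (cyclic_subgroups G)))
  => [|x Gx] /=; last first.
  by rewrite !inE cycle_cyclic cycle_subG Gx.
apply: eq_bigr => H; rewrite !inE => /andP[sHG /cyclicP[a defH]].
rewrite (eq_bigr (fun=> F #|H|)) => [|x /andP[_ /eqP <-] //].
rewrite sum_nat_const; congr (_ * _)%N; rewrite defH totient_gen.
apply: eq_card => x; rewrite unfold_in inE /generator -defH eq_sym.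
have -> : (H == <[x]>%G) = (H == <[x]> :> {set gT}) by [].
by rewrite andb_idl // => /eqP eq_Hx; rewrite -cycle_subG -eq_Hx.
Qed.

(** The solutions of [x ^+ k = 1] form the subgroup of order [gcdn k #|G|], which
    is unique since [G] is cyclic. *)
Lemma card_Ldiv_cyclic (gT : finGroupType) (G : {group gT}) k :
  cyclic G -> #|'Ldiv_k(G)| = gcdn k #|G|.
Proof.
case/cyclicP=> a defG; set d := gcdn k #|G|.
have dvd_d : d %| #[a] by rewrite /order -defG dvdn_gcdr.
have ord_d : #[a ^+ (#[a] %/ d)] = d.
  have d_gt0 : (0 < d)%N by exact: dvdn_gt0 dvd_d.
  by rewrite orderXdiv ?dvdn_div // divnA // mulKn.
rewrite -[RHS]ord_d orderE.
apply: eq_card => x; rewrite -cycle_subG; apply/LdivP/idP => [[]|sxa].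
  rewrite defG -cycle_subG => sxa /eqP; rewrite -order_dvdn => dvd_k.
  rewrite -(cardSg_cyclic (cycle_cyclic a)) ?cycleX // -!orderE ord_d.
  by rewrite dvdn_gcd dvd_k /= defG cardSg.
have sxG := subset_trans sxa (cycleX a _).
split; first by rewrite defG -cycle_subG.
apply/eqP; rewrite -order_dvdn (dvdn_trans _ (dvdn_gcdl k #|G|)) //.
by rewrite -/d -ord_d cardSg.
Qed.

Lemma Ldiv_setX (gT1 gT2 : finGroupType) (A : {set gT1}) (B : {set gT2}) k :
  'Ldiv_k(setX A B) = setX 'Ldiv_k(A) 'Ldiv_k(B).
Proof.
have pairX (x : gT1) (y : gT2) : (x, y) ^+ k = (x ^+ k, y ^+ k).
  by elim: k => // k IHk; rewrite !expgS IHk.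
apply/setP=> -[x y]; rewrite !inE pairX xpair_eqE /=.
by rewrite andbACA.
Qed.

Lemma Zp_cyclic m : cyclic (Zp m).
Proof.
rewrite /Zp; case: ifP => _; last exact: cyclic1.
by apply/cyclicP; exists Zp1; apply: Zp_cycle.
Qed.

Lemma sum_shift l (F : nat -> nat) : F l = F 0 ->
  \sum_(0 <= j < l) F j.+1 = \sum_(0 <= j < l) F j.
Proof.
move=> Fl; apply/(@addnI (F 0)).
by rewrite -[LHS]big_nat_recl // big_nat_recr //= Fl addnC.
Qed.

(** Both sides count the pairs of a unit [u = j.+1] modulo [l] and an [x] in [G]
    such that [x ^+ u = x], on the left grouped by the subgroup generated by [x]
    and on the right by [u]. *)
Lemma cyclic_subgroups_Burnside (gT : finGroupType) (G : {group gT}) l :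
    (0 < l)%N -> exponent G %| l ->
  (#|cyclic_subgroups G| * totient l
    = \sum_(0 <= j < l) coprime j.+1 l * #|'Ldiv_j(G)|)%N.
Proof.
move=> l_gt0 expG.
have dvd_l x : x \in G -> #[x] %| l.
  by move=> Gx; rewrite (dvdn_trans _ expG) ?dvdn_exponent.
transitivity (\sum_(x in G) #|unit_residues l #[x] 1|)%N.
  rewrite (sum_by_cyclic_subgroup G (fun d => #|unit_residues l d 1|)).
  rewrite -sum_nat_const; apply: eq_bigr => H.
  rewrite !inE => /andP[sHG /cyclicP[a defH]].
  rewrite defH totient_mul_card_unit_residues //; apply: dvd_l.
  by rewrite -cycle_subG -defH.
transitivity (\sum_(x in G) \sum_(0 <= j < l) coprime j.+1 l * (#[x] %| j))%N.
  apply: eq_bigr => x Gx.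
  have dvd_x := dvd_l x Gx.
  have dvd_mod j : (#[x] %| j) = (j.+1 == 1 %[mod #[x]]).
    by rewrite eqn_mod_dvd // subn1.
  under eq_bigr do rewrite dvd_mod.
  (* The representatives 1, ..., l of the residues are shifted to 0, ..., l - 1. *)
  rewrite (sum_shift (F := fun j => (coprime j l * (j == 1 %[mod #[x]]))%N)).
    rewrite big_mkord -sum1_card big_mkcond /=; apply: eq_bigr => j _.
    by rewrite inE mulnb; case: (_ && _).
  rewrite -(coprime_modl l) modnn.
  by rewrite (eqP (dvd_x : l %% _ == 0%N)) mod0n.
rewrite exchange_big /=; apply: eq_bigr => j _.
rewrite -big_distrr /= -sum1_card [in RHS]big_mkcond [in LHS]big_mkcond /=.
congr (_ * _)%N; apply: eq_bigr => x _.
rewrite !inE order_dvdn.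
by case: (x \in G); case: eqP.
Qed.

Lemma card_cyclic_subgroups_Zp_prod m n l :
    (0 < m)%N -> (0 < n)%N -> l = lcmn m n ->
  (#|cyclic_subgroups (Zp_prod m n)| * totient l
    = \sum_(0 <= j < l) coprime j.+1 l * (gcdn j m * gcdn j n))%N.
Proof.
move=> m_gt0 n_gt0 ->.
have card_Ldiv j : #|'Ldiv_j(Zp_prod m n)| = (gcdn j m * gcdn j n)%N.
  by rewrite Ldiv_setX cardsX !card_Ldiv_cyclic ?Zp_cyclic ?card_Zp.
rewrite cyclic_subgroups_Burnside ?lcmn_gt0 ?m_gt0 //.
  by apply: eq_bigr => j _; rewrite card_Ldiv.
rewrite -sub_Ldiv Ldiv_setX setXS // sub_Ldiv.
  by rewrite (dvdn_trans (exponent_dvdn _)) // card_Zp // dvdn_lcml.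
by rewrite (dvdn_trans (exponent_dvdn _)) // card_Zp // dvdn_lcmr.
Qed.

Local Close Scope group_scope.

(** * Factoring the count over the primes *)

Theorem corollary2 (m n : nat) (m_gt0 : 0 < m) (n_gt0 : 0 < n)
    (l : nat) (l_def : l = lcmn m n)
    (k : nat) (p : 'I_k -> nat)
    (p_inj : injective p)
    (p_primes : forall q : nat, (prime q /\ q %| l) <-> exists i, q = p i)
    (alpha beta : 'I_k -> nat)
    (m_fact : m = \prod_(i < k) p i ^ alpha i)
    (n_fact : n = \prod_(i < k) p i ^ beta i) :
  (#|cyclic_subgroups (Zp_prod m n)|%:R
     = (totient l)%:R^-1 *
       (\prod_(i < k)
          \sum_(1 <= j < (p i ^ maxn (alpha i) (beta i)).+1 | ~~ (p i %| j))
             gcdn (j - 1) (p i ^ alpha i) * gcdn (j - 1) (p i ^ beta i))%N%:R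
     :> rat)%R.
Proof.
have pP i : prime (p i) /\ p i %| l by apply/p_primes; exists i.
have p_pr i := (pP i).1.
pose e i := maxn (alpha i) (beta i).
have def_l : l = (\prod_(i < k) p i ^ e i)%N.
  by rewrite l_def m_fact n_fact lcmn_prod_primes.
(* Needed for coprimality to p i ^ e i to amount to not being divisible by p i. *)
have e_gt0 i : (0 < e i)%N.
  have l_gt0 : (0 < l)%N by rewrite l_def lcmn_gt0 m_gt0.
  have : (0 < logn (p i) l)%N.
    by rewrite logn_gt0 mem_primes p_pr l_gt0 (pP i).2.
  rewrite def_l logn_prod // (eq_bigl (pred1 i)) ?big_pred1_eq // => j.
  by rewrite /= (inj_eq p_inj) eq_sym.
have co_p (a : 'I_k -> nat) i j : i != j -> coprime (p i ^ a i) (p j ^ a j).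
  move=> neq_ij; rewrite coprimeXl // coprimeXr // prime_coprime //.
  by rewrite dvdn_prime2 // (inj_eq p_inj).
pose f i j := (coprime j.+1 (p i ^ e i)
                * (gcdn j (p i ^ alpha i) * gcdn j (p i ^ beta i)))%N.
have per_f i : periodic (p i ^ e i) (f i).
  have dvd_a : p i ^ alpha i %| p i ^ e i by rewrite dvdn_exp2l ?leq_maxl.
  have dvd_b : p i ^ beta i %| p i ^ e i by rewrite dvdn_exp2l ?leq_maxr.
  move=> j; rewrite /f -(coprime_modl (j %% _).+1).
  rewrite -addn1 modnDml addn1 coprime_modl.
  rewrite -(gcdn_modl (j %% _)) modn_dvdm // gcdn_modl.
  by rewrite -(gcdn_modl (j %% _)) modn_dvdm // gcdn_modl.
have key : (#|cyclic_subgroups (Zp_prod m n)| * totient l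
   = \prod_(i < k) \sum_(0 <= j < p i ^ e i) f i j)%N.
  rewrite (card_cyclic_subgroups_Zp_prod m_gt0 n_gt0 l_def).
  rewrite -sum_prod_CRT ?index_enum_uniq // => [|i j _ _]; last exact: co_p.
  rewrite -def_l; apply: eq_bigr => j _.
  rewrite !big_split prod_nat_of_bool -coprime_prod -def_l /=.
  rewrite m_fact n_fact !gcdn_prod ?index_enum_uniq // => i1 i2 _ _;
    exact: co_p.
have -> : (\prod_(i < k)
          \sum_(1 <= j < (p i ^ maxn (alpha i) (beta i)).+1 | ~~ (p i %| j))
             gcdn (j - 1) (p i ^ alpha i) * gcdn (j - 1) (p i ^ beta i) =
   \prod_(i < k) \sum_(0 <= j < p i ^ e i) f i j)%N.
  apply: eq_bigr => i _; rewrite big_mkcond big_add1 /=; apply: eq_bigr => j _.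
  rewrite /f coprime_pexpr // coprime_sym prime_coprime // subn1 /=.
  by case: (p i %| j.+1); rewrite ?mul0n ?mul1n.
rewrite -key GRing.natrM GRing.mulrC GRing.mulfK //.
by rewrite Num.Theory.pnatr_eq0 -lt0n totient_gt0 l_def lcmn_gt0 m_gt0.
Qed.
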